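(* Let $G=\langle a,b\mid r=1\rangle$ be a $2$-generator free-by-cyclic one-relator group. Suppose that the relator $r$ has $a$-exponent sum equal to zero and $b$-exponent sum not equal to zero. Then for any finite set of words $w_1,\dots,w_k$ over $\{a,b\}^{\pm1}$, all with $a$-exponent sum at least zero, membership in the submonoid $M$ of $G$ generated by $w_1,\dots,w_k$ is decidable. In particular, $G$ has decidable positivity problem.
   Context: A group $G$ is free-by-cyclic if there is a surjective homomorphism $\phi:G\to\mathbb{Z}$ such that $\ker(\phi)$ is a free group. The $a$-exponent sum of a word is the number of occurrences of $a$ minus the number of occurrences of $a^{-1}$ (similarly for $b$). For a group $G$ generated by a finite set $B$ and a finitely generated submonoid $M\leq G$, membership in $M$ is decidable if there is an algorithm that takes any word over $B\cup B^{-1}$ and decides whether the element of $G$ it represents belongs to $M$. The group $G=\langle B\mid R\rangle$ has decidable positivity problem (with respect to this presentation) if membership in the submonoid of $G$ generated by $B$ is decidable. *)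

(* Defs.v *)
From HB Require Import structures.
From mathcomp Require Import all_boot all_order all_algebra.

Set Implicit Arguments.
Unset Strict Implicit.
Unset Printing Implicit Defensive.

(* The total recursive (computable) functions on nat: the least class that
   contains the initial functions and is closed under composition, primitive
   recursion and minimization of regular functions (those g such that for all v
   there is x with g (x :: v) = 0).  The constructors constrain the resulting
   function pointwise, so the class is closed under extensional equality. *)
Inductive recursive : forall n : nat, (n.-tuple nat -> nat) -> Prop :=
| recursive_zero n : recursive (fun _ : n.-tuple nat => 0)
| recursive_succ : recursive (fun v : 1.-tuple nat => (thead v).+1)
| recursive_proj n (i : 'I_n) : recursive (fun v : n.-tuple nat => tnth v i)
| recursive_comp m n (f : m.-tuple nat -> nat) (g : 'I_m -> n.-tuple nat -> nat)
    (h : n.-tuple nat -> nat) :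
    recursive f -> (forall i, recursive (g i)) ->
    (forall v, h v = f [tuple g i v | i < m]) ->
    recursive h
| recursive_primrec n (f : n.-tuple nat -> nat) (g : n.+2.-tuple nat -> nat)
    (h : n.+1.-tuple nat -> nat) :
    recursive f -> recursive g ->
    (forall v : n.-tuple nat, h [tuple of 0 :: v] = f v) ->
    (forall k (v : n.-tuple nat),
      h [tuple of k.+1 :: v] = g [tuple of k :: h [tuple of k :: v] :: v]) ->
    recursive h
| recursive_min n (g : n.+1.-tuple nat -> nat) (h : n.-tuple nat -> nat) :
    recursive g ->
    (forall v : n.-tuple nat, g [tuple of h v :: v] = 0) ->
    (forall (v : n.-tuple nat) x, x < h v -> g [tuple of x :: v] <> 0) ->
    recursive h.

(* The letter (x, false) stands for x and (x, true) for x^-1; words are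
   arbitrary, not necessarily reduced. *)
Definition word (B : Type) := seq (B * bool).

Definition inv_letter (B : Type) (l : B * bool) : B * bool := (l.1, ~~ l.2).

Definition reduced (B : eqType) (w : word B) : bool :=
  sorted (fun l m => m != inv_letter l) w.

Definition eval (B : Type) (G : groupType) (gen : B -> G) (w : word B) : G :=
  \big[*%g/1%g]_(l <- w) (if l.2 then (gen l.1)^-1 else gen l.1)%g.

Definition exponent_sum (B : eqType) (x : B) (w : word B) : int :=
  ((count_mem (x, false) w)%:Z - (count_mem (x, true) w)%:Z)%R.

(* u and v represent the same element of the group < B | R >. *)
Inductive word_eq (B : Type) (R : word B -> Prop) : word B -> word B -> Prop :=
| word_eq_refl u : word_eq R u u
| word_eq_sym u v : word_eq R u v -> word_eq R v u
| word_eq_trans u v w : word_eq R u v -> word_eq R v w -> word_eq R u w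
| word_eq_cat u u' v v' :
    word_eq R u u' -> word_eq R v v' -> word_eq R (u ++ v) (u' ++ v')
| word_eq_cancel l : word_eq R [:: l; inv_letter l] [::]
| word_eq_relator u : R u -> word_eq R u [::].

(* G = < B | R >, the generators being interpreted in G by gen. *)
Definition presents (B : Type) (R : word B -> Prop) (G : groupType)
    (gen : B -> G) : Prop :=
  (forall g : G, exists w : word B, eval gen w = g) /\
  (forall u v : word B, eval gen u = eval gen v <-> word_eq R u v).

(* The subgroup K of G is free with basis the family e. *)
Definition free_basis (G : groupType) (K : G -> Prop) (X : eqType)
    (e : X -> G) : Prop :=
  (forall x, K (e x)) /\
  (forall g, K g -> exists! w : word X, reduced w /\ eval e w = g).

Definition free_subgroup (G : groupType) (K : G -> Prop) : Prop :=
  exists (X : eqType) (e : X -> G), free_basis K e.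

Definition free_by_cyclic (G : groupType) : Prop :=
  exists phi : G -> int,
    [/\ forall g h, phi (g * h)%g = (phi g + phi h)%R,
        forall z : int, exists g, phi g = z &
        free_subgroup (fun g => phi g = 0%R)].

Inductive submonoid_gen (G : groupType) (S : G -> Prop) : G -> Prop :=
| submonoid_gen_in g : S g -> submonoid_gen S g
| submonoid_gen_one : submonoid_gen S 1%g
| submonoid_gen_mul g h :
    submonoid_gen S g -> submonoid_gen S h -> submonoid_gen S (g * h)%g.

(* Goedel number of a word over a finite alphabet. *)
Definition word_code (B : finType) (w : word B) : nat :=
  CodeSeq.code [seq nat_of_ord (enum_rank l) | l <- w].

(* There is an algorithm which, given any word w, decides whether P w. *)
Definition decidable_words (B : finType) (P : word B -> Prop) : Prop :=
  exists2 chi : 1.-tuple nat -> nat, recursive chi &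
    forall w : word B,
      (P w -> chi [tuple word_code w] = 1) /\
      (~ P w -> chi [tuple word_code w] = 0).

Definition decidable_membership (B : finType) (G : groupType) (gen : B -> G)
    (M : G -> Prop) : Prop :=
  decidable_words (fun w => M (eval gen w)).

Definition decidable_positivity (B : finType) (G : groupType) (gen : B -> G)
    : Prop :=
  decidable_membership gen (submonoid_gen (fun g => exists x : B, g = gen x)).

Variant ab : Type := a | b.

Definition ab_to_bool (x : ab) : bool := if x is a then false else true.
Definition ab_of_bool (x : bool) : ab := if x then b else a.
Lemma ab_to_boolK : cancel ab_to_bool ab_of_bool.
Proof. by case. Qed.

HB.instance Definition _ := Finite.copy ab (can_type ab_to_boolK).

(* Main.v *)
Require Import Defs.
From HB Require Import structures.
From mathcomp Require Import all_boot all_order all_algebra.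
From mathcomp Require Import boolp.

Set Implicit Arguments.
Unset Strict Implicit.
Unset Printing Implicit Defensive.

(** Let [t] be the image of [a]. Since the exponent sum of [b] in [r] is not
    zero, [b] is torsion in the abelianization of [G]; hence every homomorphism
    onto the integers kills [b], and up to a nonzero factor it is the exponent
    sum of [a]. Its kernel [K], free on a family [e], is the normal closure of
    [b], and [G] is the semidirect product of [K] with the powers of [t].

    The rank of [K] is finite ([finite_rank]). A homomorphism from [K] to the
    rationals is determined by its values on the conjugates of [b] by the powers
    of [t], and these values satisfy the linear recurrence read off the
    conjugates of [r]. The coefficients of the recurrence add up to the exponent
    sum of [b] in [r], so they are not all zero, and the space of such
    homomorphisms is finite dimensional, whereas a free group of infinite rank
    has an infinite dimensional one.

    A word [w] in [a] and [b] is rewritten as a word over the finite basis of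
    [K] times a power of [t] ([eval_rewrite_word]). A product of the given words
    never descends, because their exponent sums of [a] are nonnegative; so it
    visits only the finitely many powers of [t] between the ends prescribed by
    [w]. Membership of [w] thus says that a finite automaton over the basis of
    [K], with those powers as its main states, has a run between two given
    states whose label is trivial in [K] ([acceptsP]). This is decided by the
    saturation argument of Benois: the pairs of states joined by a run with
    trivial label form the least relation containing the silent moves and closed
    under composition and under the cancellation of adjacent inverse letters
    ([run_dyck]), and that relation is reached after finitely many rounds
    ([saturateP]).

    The decision procedure only manipulates lists over finite alphabets. It is
    recursive because lists and pairs are encoded by a recursive pairing of
    natural numbers, for which folding a list is a primitive recursion
    ([computable_foldl]); every other list operation is a fold. *)

(** * Recursive functions of one and two arguments *)

Definition recursive1 (f : nat -> nat) :=
  recursive (fun v : 1.-tuple nat => f (thead v)).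

Definition recursive2 (f : nat -> nat -> nat) :=
  recursive (fun v : 2.-tuple nat => f (tnth v ord0) (tnth v (lift ord0 ord0))).

Lemma recursive_ext n (f g : n.-tuple nat -> nat) :
  recursive f -> f =1 g -> recursive g.
Proof.
move=> rf fg; apply: (recursive_comp rf (fun i => recursive_proj i)) => v.
by rewrite -fg; congr f; apply: eq_from_tnth => i; rewrite tnth_mktuple.
Qed.

Lemma recursive_app1 f n (F : n.-tuple nat -> nat) :
  recursive1 f -> recursive F -> recursive (fun v => f (F v)).
Proof.
move=> rf rF.
apply: (recursive_comp rf (g := fun _ => F)) => // v.
by rewrite [thead _]tnth_mktuple.
Qed.

Lemma recursive_app2 f n (F G : n.-tuple nat -> nat) :
  recursive2 f -> recursive F -> recursive G ->
  recursive (fun v => f (F v) (G v)).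
Proof.
move=> rf rF rG.
apply: (recursive_comp rf (g := fun i => if i == ord0 then F else G)).
  by move=> i; case: ifP.
by move=> v; rewrite !tnth_mktuple.
Qed.

Lemma recursive_const n k : recursive (fun _ : n.-tuple nat => k).
Proof.
elim: k => [|k IH]; first exact: recursive_zero.
exact: recursive_app1 recursive_succ IH.
Qed.

Lemma recursive1_id : recursive1 id.
Proof. exact: recursive_proj. Qed.

Lemma recursive1_comp f g :
  recursive1 f -> recursive1 g -> recursive1 (fun x => f (g x)).
Proof. exact: recursive_app1. Qed.

Lemma recursive1_app2 f g h :
  recursive2 f -> recursive1 g -> recursive1 h ->
  recursive1 (fun x => f (g x) (h x)).
Proof. exact: recursive_app2. Qed.

Lemma recursive1_const k : recursive1 (fun _ => k).
Proof. exact: recursive_const. Qed.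

Lemma recursive2_flip f : recursive2 f -> recursive2 (fun x y => f y x).
Proof. by move=> rf; apply: recursive_app2 rf _ _; apply: recursive_proj. Qed.

Lemma recursive2_primrec (f : nat -> nat) (g : nat -> nat -> nat -> nat) h :
  recursive1 f ->
  recursive (fun v : 3.-tuple nat =>
    g (tnth v ord0) (tnth v (lift ord0 ord0))
      (tnth v (lift ord0 (lift ord0 ord0)))) ->
  (forall y, h 0 y = f y) -> (forall k y, h k.+1 y = g k (h k y) y) ->
  recursive2 h.
Proof.
move=> rf rg h0 hS; apply: (recursive_primrec rf rg) => [v | k v].
  by rewrite tnth0 tnthS.
by rewrite !(tnth0, tnthS).
Qed.

Lemma recursive2_iter f g :
  recursive1 f -> recursive1 g -> recursive2 (fun n x => iter n g (f x)).
Proof.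
move=> rf rg.
apply: (recursive2_primrec (g := fun _ y _ => g y) rf) => //.
by apply: recursive_app1 rg _; apply: recursive_proj.
Qed.

Lemma recursive1_iter f g n :
  recursive1 f -> recursive1 g -> recursive1 n ->
  recursive1 (fun x => iter (n x) g (f x)).
Proof.
move=> rf rg rn.
exact: recursive1_app2 (recursive2_iter rf rg) rn recursive1_id.
Qed.

Lemma recursive1_primrec k (g : nat -> nat -> nat) h :
  recursive2 g -> h 0 = k -> (forall n, h n.+1 = g n (h n)) -> recursive1 h.
Proof.
move=> rg h0 hS.
apply: (@recursive1_app2 (fun n _ => h n) id id); try exact: recursive1_id.
apply: (recursive2_primrec (g := fun n y _ => g n y) (recursive1_const k)) => //.
by apply: recursive_app2 rg _ _; apply: recursive_proj.
Qed.

Lemma recursive2_addn : recursive2 addn.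
Proof.
apply: recursive_ext (recursive2_iter recursive1_id recursive_succ) _ => v.
by rewrite /= iter_succn addnC.
Qed.

Lemma recursive1_pred : recursive1 predn.
Proof.
by apply: (@recursive1_primrec 0 (fun n _ => n)) => //; apply: recursive_proj.
Qed.

Lemma recursive2_subn : recursive2 subn.
Proof.
have := recursive2_flip (recursive2_iter recursive1_id recursive1_pred).
by move=> /recursive_ext; apply => v; exact: iter_predn.
Qed.

Lemma recursive1_if (c f g : nat -> nat) :
  recursive1 c -> recursive1 f -> recursive1 g ->
  recursive1 (fun x => if c x == 0 then f x else g x).
Proof.
move=> rc rf rg.
apply: (@recursive1_app2 (fun k y => if k == 0 then f y else g y) c id) => //.
  apply: (recursive2_primrec (g := fun _ _ y => g y) rf) => //.
  by apply: recursive_app1 rg _; apply: recursive_proj.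
exact: recursive1_id.
Qed.

Lemma recursive1_eq (f g : nat -> nat) :
  recursive1 f -> recursive1 g -> recursive1 (fun x => f x == g x : nat).
Proof.
move=> rf rg.
have rd h k : recursive1 h -> recursive1 k -> recursive1 (fun x => h x - k x).
  exact: recursive1_app2 recursive2_subn.
have /recursive_ext := recursive1_if (recursive1_app2 recursive2_addn
  (rd _ _ rf rg) (rd _ _ rg rf)) (recursive1_const 1) (recursive1_const 0).
by apply=> v; rewrite /= addn_eq0 !subn_eq0 -eqn_leq; case: eqP.
Qed.

Lemma recursive1_odd : recursive1 (fun n => odd n : nat).
Proof.
apply: (@recursive1_primrec 0 (fun _ b => 1 - b)) => // [|n /=].
  apply: (recursive_app2 recursive2_subn); first exact: recursive_const.
  exact: recursive_proj.
by case: odd.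
Qed.

Lemma recursive1_half : recursive1 half.
Proof.
apply: (@recursive1_primrec 0 (fun n m => odd n + m)) => // [|n].
  apply: (recursive_app2 recursive2_addn); last exact: recursive_proj.
  by apply: (recursive_app1 recursive1_odd); apply: recursive_proj.
exact: uphalf_half.
Qed.

(** * A recursive pairing *)

(** This is the step of [CodeSeq.code]: the code of [x :: s] is
    [cons_code x (CodeSeq.code s)]. Used as a pairing function as well, it lets
    one pair of projections serve both lists and pairs. *)
Definition cons_code m n := 2 ^ m * n.*2.+1.
Definition car_code := logn 2.
Definition cdr_code n := (n %/ 2 ^ car_code n)./2.

Lemma cons_codeK1 m n : car_code (cons_code m n) = m.
Proof.
rewrite /car_code /cons_code lognM ?expn_gt0 // pfactorK //.
by rewrite logn_coprime ?addn0 // coprime2n /= odd_double.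
Qed.

Lemma cons_codeK2 m n : cdr_code (cons_code m n) = n.
Proof.
by rewrite /cdr_code cons_codeK1 mulKn ?expn_gt0 //= uphalf_double.
Qed.

Lemma cons_code_neq0 m n : cons_code m n != 0.
Proof. by rewrite muln_eq0 expn_eq0. Qed.

Lemma iter_half m n : iter m half n = n %/ 2 ^ m.
Proof.
by elim: m => [|m IH]; rewrite ?divn1 //= IH -divn2 expnSr divnMA.
Qed.

Lemma recursive1_cons f g :
  recursive1 f -> recursive1 g -> recursive1 (fun x => cons_code (f x) (g x)).
Proof.
move=> rf rg.
have rdbl : recursive1 double.
  have r2 := recursive1_app2 recursive2_addn recursive1_id recursive1_id.
  apply: recursive_ext r2 _ => v.
  exact: addnn.
have r1 : recursive1 (fun x => (g x).*2.+1).
  by apply: recursive1_comp recursive_succ _; apply: recursive1_comp rdbl rg.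
apply: recursive_ext (recursive1_iter r1 rdbl rf) _ => v.
by elim: (f _) => [|m IH]; rewrite /cons_code ?mul1n //= IH expnS -mul2n mulnA.
Qed.

(** This singles out [car_code n] as the least [x] with [n %/ 2 ^ x] odd, which
    is how minimization finds it. *)
Lemma odd_divn_car x n :
  0 < n -> x <= car_code n -> odd (n %/ 2 ^ x) = (x == car_code n).
Proof.
move=> n_gt0 le_x.
have [m m_odd def_n] := pfactor_coprime (isT : prime 2) n_gt0.
rewrite {1}def_n -/(car_code n) -(subnK le_x) expnD mulnA mulnK ?expn_gt0 //.
by rewrite oddM -coprime2n m_odd oddX orbF subnK // subn_eq0 eqn_leq le_x.
Qed.

Lemma recursive1_car : recursive1 car_code.
Proof.
pose g x n := if n == 0 then 0 else 1 - odd (n %/ 2 ^ x).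
apply: (@recursive_min 1 (fun v => g (tnth v ord0) (tnth v (lift ord0 ord0)))).
- have rshr : recursive2 (fun m n => n %/ 2 ^ m).
    apply: recursive_ext (recursive2_iter recursive1_id recursive1_half) _ => v.
    exact: iter_half.
  have ro : recursive2 (fun m n => 1 - odd (n %/ 2 ^ m)).
    apply: (recursive_app2 recursive2_subn); first exact: recursive_const.
    exact: (recursive_app1 recursive1_odd).
  have rif : recursive2 (fun k y => if k == 0 then 0 else y).
    apply: (recursive2_primrec (g := fun _ _ y => y) (recursive1_const 0)) => //.
    exact: recursive_proj.
  by apply: (recursive_app2 rif) => //; apply: recursive_proj.
- move=> v; rewrite tnth0 tnthS /g /thead; case: posnP => // v_gt0.
  by rewrite odd_divn_car ?eqxx.
- move=> v x; rewrite tnth0 tnthS /g /thead => x_lt.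
  case: posnP => [v0 | v_gt0]; first by rewrite v0 in x_lt.
  by rewrite odd_divn_car ?(ltnW x_lt) // ltn_eqF.
Qed.

Lemma recursive1_cdr : recursive1 cdr_code.
Proof.
apply: recursive1_comp recursive1_half _.
have r2 := recursive1_iter recursive1_id recursive1_half recursive1_car.
apply: recursive_ext r2 _ => v.
exact: iter_half.
Qed.

(** * Computable functions between encoded types *)

Class encoding (T : Type) :=
  Encoding { enc : T -> nat; enc_inj : injective enc }.

#[export] Instance encoding_bool : encoding bool.
Proof. by exists nat_of_bool; case; case. Defined.

#[export] Instance encoding_prod S T {eS : encoding S} {eT : encoding T} :
  encoding (S * T).
Proof.
exists (fun p => cons_code (enc p.1) (enc p.2)) => -[x y] [x' y'] /= eq_p.
congr (_, _); apply: enc_inj.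
  by rewrite -(cons_codeK1 (enc x) (enc y)) eq_p cons_codeK1.
by rewrite -(cons_codeK2 (enc x) (enc y)) eq_p cons_codeK2.
Defined.

#[export] Instance encoding_seq T {eT : encoding T} : encoding (seq T).
Proof.
exists (fun s => CodeSeq.code [seq enc x | x <- s]).
exact: inj_comp (can_inj CodeSeq.codeK) (inj_map enc_inj).
Defined.

(** Codes need not fill the natural numbers, so [g] is unconstrained off the
    codes of [A]. *)
Definition computable A B {eA : encoding A} {eB : encoding B} (f : A -> B) :=
  exists2 g : nat -> nat, recursive1 g & forall x, g (enc x) = enc (f x).

Section Computable.
Context {A B C D R : Type} {eA : encoding A} {eB : encoding B} {eC : encoding C}
  {eD : encoding D} {eR : encoding R}.

Lemma computable_id : computable (@id A).
Proof. by exists id; first exact: recursive1_id. Qed.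

Lemma computable_comp (f : B -> C) (g : A -> B) :
  computable f -> computable g -> computable (fun x => f (g x)).
Proof.
case=> F rF Ff [G rG Gg]; exists (fun n => F (G n)).
  exact: recursive1_comp.
by move=> x; rewrite Gg Ff.
Qed.

Lemma computable_const (y : B) : computable (fun _ : A => y).
Proof. by exists (fun=> enc y); first exact: recursive1_const. Qed.

Lemma computable_pair (f : A -> B) (g : A -> C) :
  computable f -> computable g -> computable (fun x => (f x, g x)).
Proof.
case=> F rF Ff [G rG Gg]; exists (fun n => cons_code (F n) (G n)).
  exact: recursive1_cons.
by move=> x; rewrite Ff Gg.
Qed.

Lemma computable_fst (f : A -> B * C) :
  computable f -> computable (fun x => (f x).1).
Proof.
case=> F rF Ff; exists (fun n => car_code (F n)).
  exact: recursive1_comp recursive1_car rF.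
by move=> x; rewrite Ff cons_codeK1.
Qed.

Lemma computable_snd (f : A -> B * C) :
  computable f -> computable (fun x => (f x).2).
Proof.
case=> F rF Ff; exists (fun n => cdr_code (F n)).
  exact: recursive1_comp recursive1_cdr rF.
by move=> x; rewrite Ff cons_codeK2.
Qed.

Lemma computable_cons (f : A -> B) (s : A -> seq B) :
  computable f -> computable s -> computable (fun x => f x :: s x).
Proof.
case=> F rF Ff [G rG Gg]; exists (fun n => cons_code (F n) (G n)).
  exact: recursive1_cons.
by move=> x; rewrite Ff Gg.
Qed.

Lemma computable_if (c : A -> bool) (f g : A -> B) :
  computable c -> computable f -> computable g ->
  computable (fun x => if c x then f x else g x).
Proof.
case=> H rH Hc [F rF Ff] [G rG Gg].
exists (fun n => if H n == 0 then G n else F n); first exact: recursive1_if.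
by move=> x; rewrite Hc Ff Gg; case: (c x).
Qed.

(** After [k] steps the state holds the parameter, the unread suffix of the
    list and the accumulator; the code of a list bounds its length, and a
    state with nothing left to read is stationary. *)
Lemma computable_foldl (f : A -> R -> B -> R) (z : A -> R) (s : A -> seq B) :
  computable (fun p : A * (R * B) => f p.1 p.2.1 p.2.2) ->
  computable z -> computable s ->
  computable (fun x => foldl (f x) (z x) (s x)).
Proof.
case=> F rF Ff [Z rZ Zz] [S rS Ss].
pose unread st := car_code (cdr_code st).
pose acc st := cdr_code (cdr_code st).
pose step st := if unread st == 0 then st else
  cons_code (car_code st) (cons_code (cdr_code (unread st))
    (F (cons_code (car_code st) (cons_code (acc st) (car_code (unread st)))))).
have [rcar rcdr] := (recursive1_car, recursive1_cdr).
have runread : recursive1 unread by apply: (recursive1_comp rcar rcdr).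
have racc : recursive1 acc by apply: (recursive1_comp rcdr rcdr).
have rstep : recursive1 step.
  apply: recursive1_if => //; first exact: recursive1_id.
  apply: recursive1_cons => //; apply: recursive1_cons.
    exact: (recursive1_comp rcdr runread).
  apply: (recursive1_comp rF); apply: recursive1_cons => //.
  by apply: recursive1_cons => //; exact: (recursive1_comp rcar runread).
exists (fun n => acc (iter (S n) step (cons_code n (cons_code (S n) (Z n))))).
  apply: recursive1_comp racc _; apply: recursive1_iter => //.
  by apply: recursive1_cons; [exact: recursive1_id | exact: recursive1_cons].
move=> x; rewrite Ss Zz.
have stepE t y : step (cons_code (enc x) (cons_code (enc t) (enc y))) =
    if t is c :: t' then
      cons_code (enc x) (cons_code (enc t') (enc (f x y c)))
    else cons_code (enc x) (cons_code (enc t) (enc y)).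
  rewrite /step /unread /acc !(cons_codeK1, cons_codeK2).
  case: t => [|c t] //; rewrite (negPf (cons_code_neq0 _ _)).
  by rewrite !(cons_codeK1, cons_codeK2) -(Ff (x, (y, c))).
have size_enc (t : seq B) : size t <= enc t.
  elim: t => // c t IH; apply: leq_trans (leq_pmull _ _); last by rewrite expn_gt0.
  by rewrite ltnS (leq_trans IH) // -addnn leq_addr.
have run n (t : seq B) (y : R) : size t <= n -> iter n step
    (cons_code (enc x) (cons_code (enc t) (enc y))) =
    cons_code (enc x) (cons_code (enc (Nil B)) (enc (foldl (f x) y t))).
  by elim: n t y => [|n IH] [|c t] y // le_n; rewrite iterSr stepE IH.
by rewrite /acc run ?size_enc // !cons_codeK2.
Qed.

End Computable.
Lemma computable_ext A B {eA : encoding A} {eB : encoding B} (f g : A -> B) :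
  computable f -> f =1 g -> computable g.
Proof. by case=> F rF Ff fg; exists F => // x; rewrite Ff fg. Qed.

Lemma computable_eq A (B : eqType) {eA : encoding A} {eB : encoding B}
  (f g : A -> B) :
  computable f -> computable g -> computable (fun x => f x == g x).
Proof.
case=> F rF Ff [G rG Gg]; exists (fun n => F n == G n : nat).
  exact: recursive1_eq.
by move=> x; rewrite Ff Gg (inj_eq enc_inj).
Qed.

(** * Computable operations on lists *)

Lemma computable_rev A B {eA : encoding A} {eB : encoding B}
  (s : A -> seq B) :
  computable s -> computable (fun x => rev (s x)).
Proof.
move=> cs.
have cf : computable (fun x => foldl (fun t y => y :: t) [::] (s x)).
  apply: (computable_foldl (f := fun _ t y => y :: t)) cs.
    apply: computable_cons.
      exact: computable_snd (computable_snd computable_id).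
    exact: computable_fst (computable_snd computable_id).
  exact: computable_const.
apply: computable_ext cf _ => x; rewrite /rev.
by elim: (s x) [::] => //= y t IH z; rewrite IH.
Qed.

Lemma computable_foldr A B C {eA : encoding A} {eB : encoding B} {eC : encoding C}
  (f : A -> B -> C -> C) (z : A -> C) (s : A -> seq B) :
  computable (fun p : A * (B * C) => f p.1 p.2.1 p.2.2) ->
  computable z -> computable s ->
  computable (fun x => foldr (f x) (z x) (s x)).
Proof.
move=> cf cz cs.
have c : computable (fun x => foldl (fun t y => f x y t) (z x) (rev (s x))).
  apply: (computable_foldl (f := fun x t y => f x y t)) cz (computable_rev cs).
  have cp : computable (fun p : A * (C * B) => (p.1, (p.2.2, p.2.1))).
    apply: computable_pair; first exact: computable_fst computable_id.
    apply: computable_pair.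
      exact: computable_snd (computable_snd computable_id).
    exact: computable_fst (computable_snd computable_id).
  exact: (computable_comp cf cp).
by apply: computable_ext c _ => x; rewrite foldl_rev.
Qed.

Lemma computable_cat A B {eA : encoding A} {eB : encoding B}
  (s t : A -> seq B) :
  computable s -> computable t -> computable (fun x => s x ++ t x).
Proof.
move=> cs ct; have c : computable (fun x => foldr cons (t x) (s x)).
  apply: (computable_foldr (f := fun _ => cons)) ct cs.
  apply: computable_cons; first exact: computable_fst (computable_snd computable_id).
  exact: computable_snd (computable_snd computable_id).
by apply: computable_ext c _ => x; elim: (s x) => //= y u ->.
Qed.

Lemma computable_map A B C {eA : encoding A} {eB : encoding B} {eC : encoding C}
  (f : A -> B -> C) (s : A -> seq B) :
  computable (fun p : A * B => f p.1 p.2) -> computable s ->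
  computable (fun x => [seq f x y | y <- s x]).
Proof.
move=> cf cs.
apply: (computable_foldr (f := fun x y t => f x y :: t)) (computable_const _) cs.
apply: computable_cons; last exact: computable_snd (computable_snd computable_id).
apply: (computable_comp cf (g := fun p : A * (B * seq C) => (p.1, p.2.1))).
apply: computable_pair; first exact: computable_fst computable_id.
exact: computable_fst (computable_snd computable_id).
Qed.

Lemma computable_filter A B {eA : encoding A} {eB : encoding B}
  (f : A -> B -> bool) (s : A -> seq B) :
  computable (fun p : A * B => f p.1 p.2) -> computable s ->
  computable (fun x => [seq y <- s x | f x y]).
Proof.
move=> cf cs.
have c : computable (fun x =>
    foldr (fun y t => if f x y then y :: t else t) [::] (s x)).
  apply: (computable_foldr (f := fun x y t => if f x y then y :: t else t))
    (computable_const _) cs.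
  have c2 : computable (fun p : A * (B * seq B) => p.2.2).
    exact: computable_snd (computable_snd computable_id).
  have c1 : computable (fun p : A * (B * seq B) => p.2.1).
    exact: computable_fst (computable_snd computable_id).
  apply: computable_if => //; last exact: computable_cons.
  apply: (computable_comp cf (g := fun p : A * (B * seq B) => (p.1, p.2.1))).
  by apply: computable_pair; first exact: computable_fst computable_id.
by apply: computable_ext c _ => x; elim: (s x).
Qed.

Lemma computable_flatten A B {eA : encoding A} {eB : encoding B}
  (s : A -> seq (seq B)) :
  computable s -> computable (fun x => flatten (s x)).
Proof.
move=> cs.
apply: (computable_foldr (f := fun _ => cat)) (computable_const _) cs.
apply: computable_cat; first exact: computable_fst (computable_snd computable_id).
exact: computable_snd (computable_snd computable_id).
Qed.

Lemma computable_allpairs A B C D {eA : encoding A} {eB : encoding B}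
  {eC : encoding C} {eD : encoding D}
  (f : A -> B -> C -> D) (s : A -> seq B) (t : A -> seq C) :
  computable (fun p : (A * B) * C => f p.1.1 p.1.2 p.2) ->
  computable s -> computable t ->
  computable (fun x => [seq f x y z | y <- s x, z <- t x]).
Proof.
move=> cf cs ct; apply: computable_flatten.
apply: (computable_map (f := fun x y => [seq f x y z | z <- t x])) cs.
apply: (computable_map (f := fun p z => f p.1 p.2 z)) cf _.
exact: (computable_comp ct (computable_fst computable_id)).
Qed.

Lemma computable_mem A (B : eqType) {eA : encoding A} {eB : encoding B}
  (f : A -> B) (s : A -> seq B) :
  computable f -> computable s -> computable (fun x => f x \in s x).
Proof.
move=> cf cs.
have c : computable (fun x => [seq y <- s x | f x == y] != [::]).
  have cn : computable negb.
    apply: computable_ext (computable_if computable_id (computable_const false)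
      (computable_const true)) _.
    by case.
  apply: (computable_comp cn); apply: computable_eq (computable_const _).
  apply: (computable_filter (f := fun x y => f x == y)) => //.
  apply: computable_eq (computable_snd computable_id).
  exact: (computable_comp cf (computable_fst computable_id)).
apply: computable_ext c _ => x; rewrite -has_filter -has_pred1.
exact: eq_has => y; rewrite eq_sym.
Qed.

(** The graph of [f] is a finite table, looked up one entry after the other. *)
Lemma computable_finite (A : eqType) B {eA : encoding A} {eB : encoding B}
  (sA : seq A) (f : A -> B) : (forall x, x \in sA) -> computable f.
Proof.
move=> covA; have [g rg gf] : exists2 g : nat -> nat, recursive1 g &
    {in sA, forall x, g (enc x) = enc (f x)}.
  elim: sA {covA} => [|x s [g rg gf]].
    by exists id; first exact: recursive1_id.
  exists (fun n => if (n == enc x : nat) == 0 then g n else enc (f x)).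
    apply: recursive1_if => //; last exact: recursive1_const.
    by apply: recursive1_eq; [exact: recursive1_id | exact: recursive1_const].
  move=> y; rewrite inE (inj_eq (@enc_inj _ eA)); case: eqVneq => [-> // | _ /= ys].
  exact: gf.
by exists g => // x; apply: gf.
Qed.

(** * Words, inverses and cancellation *)

Section Words.
Variables (B : Type) (G : groupType) (gen : B -> G).
Local Open Scope group_scope.

Definition inv_word (w : word B) : word B := rev [seq inv_letter l | l <- w].

Lemma eval_nil : eval gen [::] = 1.
Proof. exact: big_nil. Qed.

Lemma eval_cat u v : eval gen (u ++ v) = eval gen u * eval gen v.
Proof. exact: big_cat. Qed.

Lemma eval_cons l w : eval gen (l :: w) = eval gen [:: l] * eval gen w.
Proof. exact: eval_cat [:: l] w. Qed.

Lemma eval_letter l :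
  eval gen [:: l] = if l.2 then (gen l.1)^-1 else gen l.1.
Proof. exact: big_seq1. Qed.

Lemma eval_inv_letter l : eval gen [:: inv_letter l] = (eval gen [:: l])^-1.
Proof. by rewrite !eval_letter /=; case: l.2; rewrite ?invgK. Qed.

Lemma eval_inv_word w : eval gen (inv_word w) = (eval gen w)^-1.
Proof.
elim: w => [|l w IH]; first by rewrite eval_nil invg1.
rewrite eval_cons invgM -IH -eval_inv_letter /inv_word map_cons rev_cons.
by rewrite -cats1 eval_cat.
Qed.

End Words.

Section FreeBasis.
Variables (X : eqType) (G : groupType) (e : X -> G).
Local Open Scope group_scope.

Lemma not_reduced (w : word X) :
  ~~ reduced w -> exists u x v, w = u ++ [:: x, inv_letter x & v].
Proof.
rewrite /reduced; elim: w => [|x [|y w] IH] //=.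
rewrite negb_and negbK => /orP[/eqP-> | /IH [u [z [v ->]]]].
  by exists [::], x, w.
by exists (x :: u), z, v.
Qed.

Definition independent :=
  forall w : word X, reduced w -> eval e w = 1 -> w = [::].

(** A nonempty word that evaluates to the identity is not reduced, so it can be
    erased by successive cancellations of adjacent inverse letters. Read
    backwards, this is an induction principle on trivial words. *)
Lemma independent_ind (P : word X -> Prop) :
  independent -> P [::] ->
  (forall u x v, P (u ++ v) -> P (u ++ [:: x, inv_letter x & v])) ->
  forall w, eval e w = 1 -> P w.
Proof.
move=> ind P0 Pcancel w; have [n] := ubnP (size w).
elim: n w => // n IH w le_w w1.
have [w_red | /not_reduced[u [x [v def_w]]]] := boolP (reduced w).
  by rewrite (ind w).
rewrite def_w; apply/Pcancel/IH.
  by move: le_w; rewrite def_w !size_cat /= !addnS ltnS; apply: ltnW.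
move: w1; rewrite def_w eval_cat -(cat1s x) -(cat1s (inv_letter x)) !eval_cat.
by rewrite eval_inv_letter mulVKg -eval_cat.
Qed.

Lemma free_basis_independent K : free_basis K e -> K 1 -> independent.
Proof.
case=> _ uniq_e K1 w w_red w1; have [u [_ u_uniq]] := uniq_e 1 K1.
by rewrite -(u_uniq w) // (u_uniq [::]) // eval_nil.
Qed.

End FreeBasis.

(** * Runs with trivial label in a finite automaton *)

Section Dyck.
Variables (X S : eqType).
Implicit Types (eps L : seq (S * S)) (delta : seq ((X * bool) * (S * S))).

(** The automaton has the silent moves [eps] and the letter moves [delta]. *)
Inductive run eps delta : S -> word X -> S -> Prop :=
| run_nil p : run eps delta p [::] p
| run_eps p q w r :
    (p, q) \in eps -> run eps delta q w r -> run eps delta p w r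
| run_letter p x q w r : (x, (p, q)) \in delta ->
    run eps delta q w r -> run eps delta p (x :: w) r.

(** Each rule joins states between which some run has a trivial label; by
    [dyck_run] and [run_dyck] the relation is exactly that, when letters are
    read in an independent family. *)
Inductive dyck eps delta : S -> S -> Prop :=
| dyck_refl p : dyck eps delta p p
| dyck_eps p q : (p, q) \in eps -> dyck eps delta p q
| dyck_trans p q r :
    dyck eps delta p q -> dyck eps delta q r -> dyck eps delta p r
| dyck_cancel p x p' q' q :
    (x, (p, p')) \in delta -> dyck eps delta p' q' ->
    (inv_letter x, (q', q)) \in delta -> dyck eps delta p q.

Lemma run_cat eps delta p u q v r :
  run eps delta p u q -> run eps delta q v r -> run eps delta p (u ++ v) r.
Proof.
move=> pq qr.
elim: pq qr => {p u q} [//|p q w r' pq _ IH|p x q w r' pxq _ IH] /IH.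
  exact: run_eps pq.
exact: run_letter pxq.
Qed.

Lemma dyck_run (G : groupType) (e : X -> G) eps delta p q :
  dyck eps delta p q -> exists2 w, run eps delta p w q & eval e w = 1%g.
Proof.
elim=> {p q} [p | p q pq | p q r _ [u pu u1] _ [v qv v1]
    | p x p' q' q px _ [u pu u1] xq].
- by exists [::]; [exact: run_nil | exact: eval_nil].
- by exists [::]; [exact: run_eps pq (run_nil _ _ _) | exact: eval_nil].
- by exists (u ++ v); [exact: run_cat pu qv | rewrite eval_cat u1 v1 mulg1].
- exists (x :: u ++ [:: inv_letter x]).
    exact: run_letter px (run_cat pu (run_letter xq (run_nil _ _ _))).
  by rewrite eval_cons eval_cat u1 mul1g eval_inv_letter mulgV.
Qed.

(** If [dyck] pairs are allowed as silent moves, a run labelled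
    [u ++ x :: inv_letter x :: v] can be shortened to one labelled [u ++ v]: the
    part that reads [x] and its inverse is itself a [dyck] pair. Hence a run with
    trivial label can be shortened to one that reads nothing. *)
Lemma run_dyck (G : groupType) (e : X -> G) eps delta p w q :
  independent e -> run eps delta p w q -> eval e w = 1%g -> dyck eps delta p q.
Proof.
move=> ind pwq w1.
(* Runs in which any [dyck] pair is a silent move. *)
pose fix drun p (w : word X) q {struct w} := if w is x :: w' then
  exists p1 p2, [/\ dyck eps delta p p1, (x, (p1, p2)) \in delta & drun p2 w' q]
  else dyck eps delta p q.
have drun_dyck p' q' u r : dyck eps delta p' q' -> drun q' u r -> drun p' u r.
  case: u => [|x u] /= pq; first exact: dyck_trans.
  by case=> p1 [p2 [qp1 pp2 p2u]]; exists p1, p2; split=> //; apply: dyck_trans qp1.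
have pwq' : drun p w q.
  elim: pwq {w1} => {p w q} [p | p q w r pq _ | p x q w r pxq _ qwr].
  - exact: dyck_refl.
  - by apply: drun_dyck; apply: dyck_eps.
  - by exists p, q; split=> //; apply: dyck_refl.
suff: forall p', drun p' w q -> dyck eps delta p' q by apply.
move: w w1 {pwq pwq'}; apply: (independent_ind ind) => // u x v IH p'.
move=> p'w; apply: IH; elim: u p' p'w => [|y u IHu] p' /=.
  case=> p1 [p2 [p'p1 p1p2 [p3 [p4 [p2p3 p3p4 p4v]]]]].
  apply: drun_dyck p4v; apply: dyck_trans p'p1 _; exact: dyck_cancel p1p2 p2p3 p3p4.
by case=> p1 [p2 [p'p1 p1p2 /IHu p2v]]; exists p1, p2.
Qed.

Definition compose_rel L1 L2 :=
  [seq (z.1.1, z.2.2) | z <- [seq z <- [seq (s, t) | s <- L1, t <- L2]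
                                   | z.1.2 == z.2.1]].

Lemma compose_relP L1 L2 p r :
  reflect (exists2 q, (p, q) \in L1 & (q, r) \in L2)
          ((p, r) \in compose_rel L1 L2).
Proof.
apply: (iffP mapP) => [[[[p' q] [q' r']]] | [q pq qr]] /=.
  rewrite mem_filter /= => /andP[/eqP-> /allpairsP[[s t] /= [s1 t2 []]]].
  by move=> def_s def_t [-> ->]; exists q'; rewrite ?def_s ?def_t // -?def_s.
exists ((p, q), (q, r)) => //; rewrite mem_filter eqxx.
by apply/allpairsP; exists ((p, q), (q, r)).
Qed.

Definition moves delta x := [seq t.2 | t <- [seq t <- delta | t.1 == x]].

Lemma mem_moves delta x pq : (pq \in moves delta x) = ((x, pq) \in delta).
Proof.
apply/mapP/idP => [[[y t]] | xpq].
  by rewrite mem_filter /= => /andP[/eqP-> ?] ->.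
by exists (x, pq); rewrite ?mem_filter ?eqxx.
Qed.

Definition saturate_step delta L :=
  L ++ compose_rel L L ++
  flatten [seq compose_rel (compose_rel (moves delta x) L)
                           (moves delta (inv_letter x))
          | x <- [seq t.1 | t <- delta]].

Definition states eps delta :=
  [seq t.1 | t <- eps ++ [seq t.2 | t <- delta]] ++
  [seq t.2 | t <- eps ++ [seq t.2 | t <- delta]].

(** There are at most [size Q * size Q] pairs of states, so as many rounds
    suffice. They are counted by folding over the list of all pairs, of which
    only the length matters. *)
Definition saturate eps delta :=
  let Q := states eps delta in
  foldr (fun _ => saturate_step delta) ([seq (q, q) | q <- Q] ++ eps)
    [seq (p, q) | p <- Q, q <- Q].

Lemma foldr_iter A B (f : A -> A) z (s : seq B) :
  foldr (fun _ => f) z s = iter (size s) f z.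
Proof. by elim: s => //= _ s ->. Qed.

(** As long as the sequence grows, the number of distinct elements of [L n]
    is at least [n], but it cannot exceed [size U]. *)
Lemma increasing_stationary (T : eqType) (U : seq T) (L : nat -> seq T) :
  (forall n, {subset L n <= L n.+1}) -> (forall n, {subset L n <= U}) ->
  exists2 n, n <= size U & {subset L n.+1 <= L n}.
Proof.
move=> incr inU; apply: contrapT => no_n.
suff grow n : n <= (size U).+1 -> n <= size (undup (L n)).
  have := grow _ (leqnn _); rewrite leqNgt => /negP; apply.
  rewrite ltnS; apply: uniq_leq_size; first exact: undup_uniq.
  by move=> x; rewrite mem_undup; apply: inU.
elim: n => // n IH le_n; apply: leq_ltn_trans (IH (ltnW le_n)) _.
have /negP/allPn[x x1 x0] : ~ all (mem (L n)) (L n.+1).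
  by move=> /allP h; apply: no_n; exists n.
apply: (@uniq_leq_size _ (x :: undup (L n))) => [|y].
  by rewrite /= mem_undup x0 undup_uniq.
by rewrite inE !mem_undup => /predU1P[-> // | /incr].
Qed.

Lemma saturate_stepP delta L p r :
  reflect ([\/ (p, r) \in L,
    exists2 q, (p, q) \in L & (q, r) \in L |
    exists x p' r', [/\ (x, (p, p')) \in delta, (p', r') \in L &
      (inv_letter x, (r', r)) \in delta]])
    ((p, r) \in saturate_step delta L).
Proof.
apply: (iffP idP) => [|[pr | pr | [x [p' [r' [pp' pr' rr']]]]]].
- rewrite !mem_cat => /or3P[| /compose_relP | /flatten_mapP[x _]].
  + exact: Or31.
  + exact: Or32.
  + case/compose_relP=> r' /compose_relP[p']; rewrite !mem_moves => pp' pr' rr'.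
    by apply: Or33; exists x, p', r'.
- by rewrite mem_cat pr.
- by rewrite !mem_cat; apply/or3P/Or32/compose_relP.
- rewrite !mem_cat; apply/or3P/Or33/flatten_mapP; exists x.
    by apply/mapP; exists (x, (p, p')).
  apply/compose_relP; exists r'; last by rewrite mem_moves.
  by apply/compose_relP; exists p'; rewrite ?mem_moves.
Qed.

Lemma mem_states eps delta p q :
  (p, q) \in eps \/ (exists x, (x, (p, q)) \in delta) ->
  p \in states eps delta /\ q \in states eps delta.
Proof.
move=> pq; have {pq} in_pq : (p, q) \in eps ++ [seq t.2 | t <- delta].
  rewrite mem_cat; case: pq => [-> // | [x xpq]].
  by apply/orP; right; apply/mapP; exists (x, (p, q)).
by split; rewrite mem_cat; apply/orP; [left | right]; apply/mapP; exists (p, q).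
Qed.

(** The disjunct [p == q] covers the states that no move mentions. *)
Lemma saturateP eps delta p q :
  reflect (dyck eps delta p q) ((p == q) || ((p, q) \in saturate eps delta)).
Proof.
rewrite /saturate foldr_iter; set Q := states eps delta.
set U := [seq (p, q) | p <- Q, q <- Q]; set L0 := _ ++ eps.
pose L n := iter n (saturate_step delta) L0.
have incr n : {subset L n <= L n.+1} by move=> x Lx; rewrite /= mem_cat Lx.
have incr_le m n : m <= n -> {subset L m <= L n}.
  move/subnK <-; elim: (n - m) => // k IH x Lx; exact/incr/IH.
have inQ n x y : (x, y) \in L n -> x \in Q /\ y \in Q.
  elim: n x y => [|n IH] x y.
    rewrite mem_cat => /orP[/mapP[z Qz [-> ->]] // | xy].
    by apply: mem_states; left.
  case/saturate_stepP=> [/IH // | [z /IH[? _] /IH[]] // |].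
  case=> l [x' [y' [xx' _ yy']]].
  have [] := @mem_states eps delta x x'; first by right; exists l.
  have [] := @mem_states eps delta y' y; first by right; exists (inv_letter l).
  by split.
have inU n : {subset L n <= U}.
  by case=> x y /inQ[Qx Qy]; apply/allpairsP; exists (x, y).
apply: (iffP orP) => [[/eqP-> | ] | pq]; first exact: dyck_refl.
  move: (size U) p q; elim=> [|n IH] p q.
    rewrite mem_cat => /orP[/mapP[z _ [-> ->]] | /dyck_eps //].
    exact: dyck_refl.
  case/saturate_stepP=> [/IH // | [z /IH pz /IH] |].
    exact: dyck_trans pz.
  by case=> x [p' [q' [pp' /IH pq' qq']]]; exact: dyck_cancel pp' pq' qq'.
have [n le_n stat] := increasing_stationary incr inU.
suff: p = q \/ (p, q) \in L n.
  by case=> [-> | /(incr_le _ _ le_n)]; [left | right].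
have in_L0 : {subset L0 <= L n} by apply: (incr_le 0).
elim: pq => {p q} [p | p q pq | p q r _ IHp _ IHq | p x p' q' q pp' _ IH qq'].
- by left.
- by right; apply: in_L0; rewrite mem_cat pq orbT.
- case: IHp => [-> // | pq]; case: IHq => [<- | qr]; first by right.
  by right; apply: stat; apply/saturate_stepP/Or32; exists q.
- right; apply: stat; apply/saturate_stepP/Or33; exists x, p', q'; split=> //.
  case: IH => [<- | //]; apply: in_L0; rewrite mem_cat; apply/orP; left.
  apply/mapP; exists p' => //; have [] // := @mem_states eps delta p p'.
  by right; exists x.
Qed.

End Dyck.

(** * Computability of the saturation *)

(** Solves the goals that only rearrange the components of the argument. *)
Ltac computable_proj := cbv beta; lazymatch goal with
  | |- computable (fun x => x) => exact: computable_id
  | |- computable (fun x => (@?f x, @?g x)) =>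
      apply: (computable_pair (f := f) (g := g)); computable_proj
  | |- computable (fun x => fst (@?f x)) =>
      apply: (computable_fst (f := f)); computable_proj
  | |- computable (fun x => snd (@?f x)) =>
      apply: (computable_snd (f := f)); computable_proj
  | |- computable fst => exact: (computable_fst computable_id)
  | |- computable snd => exact: (computable_snd computable_id)
  | _ => try assumption
  end.

Section ComputableDyck.
Variables (X S : eqType).
Context {eX : encoding (X * bool)} {eS : encoding S}.
Variables (letters : seq (X * bool)) (lettersP : forall x, x \in letters).

Lemma computable_compose_rel A {eA : encoding A} (L1 L2 : A -> seq (S * S)) :
  computable L1 -> computable L2 ->
  computable (fun x => compose_rel (L1 x) (L2 x)).
Proof.
move=> c1 c2.
apply: (computable_map (f := fun _ z => (z.1.1, z.2.2))); first by computable_proj.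
apply: (computable_filter (f := fun _ z => z.1.2 == z.2.1)).
  by apply: computable_eq; computable_proj.
by apply: (computable_allpairs (f := fun _ s t => (s, t))); computable_proj.
Qed.

Lemma computable_moves A {eA : encoding A}
  (delta : A -> seq ((X * bool) * (S * S))) (x : A -> X * bool) :
  computable delta -> computable x ->
  computable (fun z => moves (delta z) (x z)).
Proof.
move=> cd cx; apply: (computable_map (f := fun _ t => t.2)); first by computable_proj.
apply: (computable_filter (f := fun z t => t.1 == x z)) => //.
apply: computable_eq; first by computable_proj.
exact: (computable_comp cx (computable_fst computable_id)).
Qed.

Lemma computable_saturate_step A {eA : encoding A}
  (delta : A -> seq ((X * bool) * (S * S))) (L : A -> seq (S * S)) :
  computable delta -> computable L ->
  computable (fun x => saturate_step (delta x) (L x)).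
Proof.
move=> cd cL; apply: computable_cat => //.
apply: computable_cat; first exact: computable_compose_rel.
apply: computable_flatten.
apply: (computable_map (f := fun z x => compose_rel
  (compose_rel (moves (delta z) x) (L z)) (moves (delta z) (inv_letter x)))).
  have cd' : computable (fun p : A * (X * bool) => delta p.1).
    exact: (computable_comp cd (computable_fst computable_id)).
  apply: computable_compose_rel; first apply: computable_compose_rel.
  - by apply: computable_moves; computable_proj.
  - exact: (computable_comp cL (computable_fst computable_id)).
  - apply: computable_moves => //; apply: computable_comp.
      exact: (computable_finite _ lettersP).
    by computable_proj.
by apply: (computable_map (f := fun _ t => t.1)); computable_proj.
Qed.

Lemma computable_saturate A {eA : encoding A} (eps : A -> seq (S * S))
  (delta : A -> seq ((X * bool) * (S * S))) :
  computable eps -> computable delta ->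
  computable (fun x => saturate (eps x) (delta x)).
Proof.
move=> ce cd.
have cQ : computable (fun x => states (eps x) (delta x)).
  have c : computable (fun x => eps x ++ [seq t.2 | t <- delta x]).
    apply: computable_cat => //.
    by apply: (computable_map (f := fun _ t => t.2)); computable_proj.
  apply: computable_cat.
    by apply: (computable_map (f := fun _ t => t.1)); computable_proj.
  by apply: (computable_map (f := fun _ t => t.2)); computable_proj.
apply: (computable_foldr (f := fun x _ => saturate_step (delta x))).
- apply: computable_saturate_step; last by computable_proj.
  exact: (computable_comp cd (computable_fst computable_id)).
- apply: computable_cat => //.
  by apply: (computable_map (f := fun _ q => (q, q))); computable_proj.
- by apply: (computable_allpairs (f := fun _ p q => (p, q))); computable_proj.
Qed.

End ComputableDyck.

(** * The decision procedure *)

Section Algorithm.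
Variable X : eqType.
(* For a letter [l] with image [g] in the group and with projection [s] to the
   powers of the image of [a], [base l] spells the kernel element [g * s^-1] and
   [twist l y] spells [s * y * s^-1], where [y] is a basis letter.
   The list [steps] pairs each generator of the submonoid with the power of [a]
   by which it climbs. *)
Variable base : ab * bool -> word X.
Variable twist : ab * bool -> X * bool -> word X.
Variable steps : seq (word ab * word ab).

Definition up : ab * bool := (a, false).

(** Reading from the right, a letter [l] in front of [w] contributes its kernel
    part and conjugates what was produced from [w]. *)
Definition rewrite_word (w : word ab) : word X :=
  foldr (fun l u => base l ++ flatten [seq twist l y | y <- u]) [::] w.

Definition splits T (s : seq T) : seq (T * seq T) :=
  (foldr (fun x acc => (x :: acc.1, (x, acc.1) :: acc.2)) ([::], [::]) s).2.

(** Heights are represented by the words [nseq h up], so that the lower heights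
    are the suffixes and adding heights is concatenation. *)
Definition lower_nodes (h : word ab) := h :: [seq z.2 | z <- splits h].

(** A state [(u, h)] stands for the height [h] with the word [u] still to be
    read on arrival there. *)
Definition reads (p : word X * word ab) :=
  [seq (z.1, ((z.1 :: z.2, p.2), (z.2, p.2))) | z <- splits p.1].

Definition descent (w : word ab) :=
  [seq up | l <- [seq l <- w | l == (a, true)]].
Definition ascent (w : word ab) := [seq l <- w | l == up].

(** The exponent sum of [a] in [w] may be negative. Starting at height
    [descent w] and ending at height [ascent w] expresses it as a difference of
    two natural numbers, and no run exists when it is negative. The inverse of
    the kernel part of [w] is read first, so that [w] belongs to the submonoid
    when some run to the end state has a trivial label. *)
Definition start_state w : word X * word ab :=
  (inv_word (rewrite_word (descent w ++ w)), descent w).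
Definition end_state w : word X * word ab := ([::], ascent w).

Definition step_moves w : seq ((word X * word ab) * (word X * word ab)) :=
  [seq (([::], h), (rewrite_word (h ++ s.1), h ++ s.2))
     | h <- lower_nodes (ascent w), s <- steps].

Definition read_moves w :=
  flatten [seq reads p | p <- start_state w :: [seq t.2 | t <- step_moves w]].

Definition accepts w := (start_state w == end_state w) ||
  ((start_state w, end_state w) \in saturate (step_moves w) (read_moves w)).

Section ComputableAccepts.
Context {eX : encoding (X * bool)} {eA : encoding (ab * bool)}.
Variables (letters : seq (X * bool)) (lettersP : forall x, x \in letters).

Lemma computable_rewrite_word A {eB : encoding A} (w : A -> word ab) :
  computable w -> computable (fun x => rewrite_word (w x)).
Proof.
move=> cw; apply: (computable_foldr
  (f := fun _ l u => base l ++ flatten [seq twist l y | y <- u]))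
  (computable_const _) cw.
apply: computable_cat.
  have cb : computable base.
    by apply: (computable_finite (sA := enum predT)) => l; rewrite mem_enum.
  by apply: (computable_comp cb); computable_proj.
apply: computable_flatten.
apply: (computable_map (f := fun p y => twist p.2.1 y)); last by computable_proj.
have cc : computable (fun p : (ab * bool) * (X * bool) => twist p.1 p.2).
  apply: (computable_finite (sA := [seq (x, y) | x <- enum predT, y <- letters])).
  by case=> x y; apply/allpairsP; exists (x, y); rewrite mem_enum.
apply: (computable_comp cc
  (g := fun p : (A * ((ab * bool) * word X)) * (X * bool) => (p.1.2.1, p.2))).
by computable_proj.
Qed.

Lemma computable_splits A T {eB : encoding A} {eT : encoding T} (s : A -> seq T) :
  computable s -> computable (fun x => splits (s x)).
Proof.
move=> cs; apply: computable_snd.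
apply: (computable_foldr (f := fun _ x acc => (x :: acc.1, (x, acc.1) :: acc.2)))
  (computable_const _) cs.
by apply: computable_pair; apply: computable_cons; computable_proj.
Qed.

Lemma computable_accepts : computable accepts.
Proof.
have c_ascent : computable ascent.
  apply: (computable_filter (f := fun _ l => l == up)); last exact: computable_id.
  by apply: computable_eq; [computable_proj | exact: computable_const].
have c_descent : computable descent.
  apply: (computable_map (f := fun _ _ => up)); first exact: computable_const.
  apply: (computable_filter (f := fun _ l => l == (a, true))).
  2: exact: computable_id.
  by apply: computable_eq; [computable_proj | exact: computable_const].
have c_start : computable start_state.
  apply: computable_pair => //; apply: computable_rev.
  apply: (computable_map (f := fun _ l => inv_letter l)).
    apply: computable_comp; first exact: (computable_finite _ lettersP).
    by computable_proj.
  by apply/computable_rewrite_word/computable_cat; last exact: computable_id.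
have c_end : computable end_state.
  by apply: computable_pair; first exact: computable_const.
have c_eps : computable step_moves.
  apply: (computable_allpairs
    (f := fun _ h s => (([::], h), (rewrite_word (h ++ s.1), h ++ s.2)))).
  - apply: computable_pair.
      by apply: computable_pair; [exact: computable_const | computable_proj].
    apply: computable_pair; last by apply: computable_cat; computable_proj.
    by apply/computable_rewrite_word/computable_cat; computable_proj.
  - apply: computable_cons => //.
    apply: (computable_map (f := fun _ z => z.2)); first by computable_proj.
    exact: computable_splits.
  - exact: computable_const.
have c_delta : computable read_moves.
  apply: computable_flatten; apply: (computable_map (f := fun _ p => reads p)).
    apply: (computable_map
      (f := fun p z => (z.1, ((z.1 :: z.2, p.2.2), (z.2, p.2.2))))).
      apply: computable_pair; first by computable_proj.
      apply: computable_pair; last by computable_proj.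
      by apply: computable_pair; [apply: computable_cons|]; computable_proj.
    by apply: computable_splits; computable_proj.
  apply: computable_cons => //.
  by apply: (computable_map (f := fun _ t => t.2)); computable_proj.
apply: (computable_ext (f := fun w =>
  if start_state w == end_state w then true else
  (start_state w, end_state w) \in saturate (step_moves w) (read_moves w))) => //.
apply: computable_if; [exact: computable_eq | exact: computable_const |].
apply: computable_mem; first exact: computable_pair.
exact: (computable_saturate lettersP).
Qed.

End ComputableAccepts.

Lemma mem_splits (T : eqType) (s : seq T) x v :
  reflect (exists u, s = u ++ x :: v) ((x, v) \in splits s).
Proof.
rewrite /splits.
have fstE (t : seq T) :
    (foldr (fun x acc => (x :: acc.1, (x, acc.1) :: acc.2)) ([::], [::]) t).1 = t.
  by elim: t => //= y t ->.
elim: s => [|y s IH] /=; first by right=> -[[]].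
rewrite fstE inE.
apply: (iffP predU1P) => [[[-> ->] | /IH[u ->]] | [[|z u] [-> def_s]]].
- by exists [::].
- by exists (y :: u).
- by left; rewrite def_s.
- by right; apply/IH; exists u.
Qed.

End Algorithm.

(** * Correctness of the decision procedure *)

Section Correctness.
Variables (G : groupType) (gen : ab -> G) (X : eqType) (e : X -> G).
Local Open Scope group_scope.

(** The complement of the kernel: it has the same exponent sums of [a] as
    [gen], but lives in the powers of [gen a]. *)
Definition a_part (x : ab) : G := if x is a then gen a else 1.

Variable base : ab * bool -> word X.
Variable twist : ab * bool -> X * bool -> word X.
Hypothesis e_ind : independent e.
Hypothesis eval_base : forall l,
  eval e (base l) = eval gen [:: l] * (eval a_part [:: l])^-1.
Hypothesis eval_twist : forall l y, eval e (twist l y) =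
  eval a_part [:: l] * eval e [:: y] * (eval a_part [:: l])^-1.

Lemma eval_rewrite_word w :
  eval e (rewrite_word base twist w) = eval gen w * (eval a_part w)^-1.
Proof.
have eval_sub l u : eval e (flatten [seq twist l y | y <- u]) =
    eval a_part [:: l] * eval e u * (eval a_part [:: l])^-1.
  elim: u => [|y u IH] /=; first by rewrite !eval_nil mulg1 mulgV.
  by rewrite eval_cat IH eval_twist (eval_cons _ y u) !mulgA mulgVK.
rewrite /rewrite_word; elim: w => [|l w IH] /=.
  by rewrite !eval_nil invg1 mulg1.
rewrite eval_cat eval_sub IH eval_base (eval_cons gen l w) (eval_cons a_part l w).
by rewrite invgM !mulgA mulgVK.
Qed.

Lemma eval_a_part w :
  eval a_part w = gen a ^+ count_mem up w * (gen a ^+ count_mem (a, true) w)^-1.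
Proof.
have comm n : gen a * gen a ^- n = gen a ^- n * gen a.
  exact/commute_sym/commute_sym/commuteV/commuteX/commute_refl.
elim: w => [|[[] []] w IH] /=; first by rewrite eval_nil mulgV.
- rewrite (eval_cons _ _ w) IH eval_letter /= add0n add1n expgSr invgM.
  by rewrite !mulgA -(commuteX _ (commute_sym (commuteV (commute_refl (gen a))))).
- by rewrite (eval_cons _ _ w) IH eval_letter /= add0n add1n expgS mulgA.
- by rewrite (eval_cons _ _ w) IH eval_letter /= invg1 mul1g.
- by rewrite (eval_cons _ _ w) IH eval_letter /= mul1g.
Qed.

Lemma eval_nseq_up n : eval gen (nseq n up) = gen a ^+ n.
Proof.
by elim: n => [|n IH]; rewrite ?eval_nil //= eval_cons IH eval_letter expgS.
Qed.

Lemma eval_a_part_nseq_up n : eval a_part (nseq n up) = gen a ^+ n.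
Proof.
by elim: n => [|n IH]; rewrite ?eval_nil //= eval_cons IH eval_letter expgS.
Qed.

Lemma ascentE w : ascent w = nseq (count_mem up w) up.
Proof.
by rewrite /ascent; elim: w => //= l w IH; case: eqP => [-> | ] //=; rewrite IH.
Qed.

Lemma descentE w : descent w = nseq (count_mem (a, true) w) up.
Proof.
by rewrite /descent; elim: w => //= l w IH; case: eqP => [-> | ] //=; rewrite IH.
Qed.

Lemma exponent_sum_cat (B : eqType) (x : B) u v :
  exponent_sum x (u ++ v) = (exponent_sum x u + exponent_sum x v)%R.
Proof. by rewrite /exponent_sum !count_cat !PoszD GRing.opprD GRing.addrACA. Qed.

Variable ws : seq (word ab).
Hypothesis ws_ge0 : forall w, w \in ws -> (0 <= exponent_sum a w)%R.
Hypothesis exponent_sum_eval : forall u v, eval gen u = eval gen v ->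
  exponent_sum a u = exponent_sum a v.

Let steps := [seq (w, nseq `|exponent_sum a w|%N up) | w <- ws].
Let M := submonoid_gen (fun g => exists2 w, w \in ws & g = eval gen w).
Let rw := rewrite_word base twist.

Lemma eval_a_part_step w : w \in ws ->
  eval a_part w = gen a ^+ `|exponent_sum a w|%N.
Proof.
move=> /ws_ge0; rewrite eval_a_part /exponent_sum.
set m := count_mem _ w; set n := count_mem _ w => le_nm.
have {}le_nm : n <= m by rewrite -lez_nat -Num.Theory.subr_ge0.
by rewrite subzn //= expgnFr.
Qed.

Lemma submonoid_genP g :
  M g <-> exists2 us, {subset us <= ws} & g = eval gen (flatten us).
Proof.
split=> [|[us]].
  elim=> {g} [_ [w ws_w ->] | | g h _ [us us_ws ->] _ [vs vs_ws ->]].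
  - by exists [:: w]; rewrite /= ?cats0 // => w'; rewrite inE => /eqP->.
  - by exists [::]; rewrite ?eval_nil.
  exists (us ++ vs); last by rewrite flatten_cat eval_cat.
  by move=> w; rewrite mem_cat => /orP[/us_ws | /vs_ws].
elim: us g => [|w us IH] g us_ws ->.
  by rewrite eval_nil; apply: submonoid_gen_one.
rewrite /= eval_cat; apply: submonoid_gen_mul.
  by apply: submonoid_gen_in; exists w; rewrite // us_ws ?mem_head.
by apply: IH => // w' us_w'; apply: us_ws; rewrite inE us_w' orbT.
Qed.

Lemma mem_lower_nodes n h :
  reflect (exists2 k, k <= n & h = nseq k up) (h \in lower_nodes (nseq n up)).
Proof.
apply: (iffP idP) => [|[k le_kn ->]].
  rewrite inE => /predU1P[-> | /mapP[[x v] /mem_splits[u def_n] ->]].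
    by exists n.
  exists (size v) => /=.
    by rewrite -(size_nseq n up) def_n size_cat /= addnS ltnW // ltnS leq_addl.
  apply/all_pred1P; have : all (pred1 up) (nseq n up).
    by apply/all_pred1P; rewrite size_nseq.
  by rewrite def_n all_cat /= => /and3P[].
rewrite inE; case: ltngtP le_kn => // [lt_kn _ | -> _]; last by rewrite eqxx.
apply/orP; right; apply/mapP; exists (up, nseq k up) => //; apply/mem_splits.
exists (nseq (n - k.+1) up); rewrite -[up :: _]/(nseq k.+1 up) -nseqD subnK //.
Qed.

(** Chosen so that reading a letter [x] divides the value by [x] on the left,
    and a silent move multiplies it on the right by a generator of the
    submonoid. *)
Definition state_value (p : word X * word ab) := eval e p.1 * eval a_part p.2.

Lemma step_movesP w p q :
  reflect (exists k v, [/\ k <= count_mem up w, v \in ws,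
      p = ([::], nseq k up) &
      q = (rw (nseq k up ++ v), nseq (k + `|exponent_sum a v|%N) up)])
    ((p, q) \in step_moves base twist steps w).
Proof.
rewrite /step_moves ascentE.
apply: (iffP allpairsP) => [[[h s]] | [k [v [le_k ws_v -> ->]]]].
  case=> /mem_lower_nodes[k le_k ->] /mapP[v ws_v ->] [-> ->] /=.
  by exists k, v; rewrite nseqD.
exists (nseq k up, (v, nseq `|exponent_sum a v|%N up)); split=> /=.
- by apply/mem_lower_nodes; exists k.
- exact: (map_f (fun w => (w, nseq `|exponent_sum a w|%N up))).
- by rewrite nseqD.
Qed.

Lemma run_sound w p u q :
  run (step_moves base twist steps w) (read_moves base twist steps w) p u q ->
  exists2 m, M m & state_value p * m = eval e u * state_value q.
Proof.
elim=> {p u q} [p | p q u r pq _ [m Mm IH] | p x q u r pxq _ [m Mm IH]].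
- by exists 1; rewrite ?eval_nil ?mul1g ?mulg1 //; apply: submonoid_gen_one.
- have [k [v [_ ws_v -> def_q]]] := step_movesP _ _ _ pq.
  exists (eval gen v * m).
    by apply: submonoid_gen_mul => //; apply: submonoid_gen_in; exists v.
  rewrite -IH def_q /state_value /= eval_nil mul1g eval_rewrite_word mulgA.
  congr (_ * _).
  rewrite nseqD !eval_cat !eval_a_part_nseq_up eval_nseq_up eval_a_part_step //.
  by rewrite mulgVK.
- exists m => //.
  case/flatten_mapP: pxq => [[u' h]] _ /mapP[[y v] _] /= [-> -> def_q].
  rewrite (eval_cons e y u) -[RHS]mulgA -IH def_q /state_value /=.
  by rewrite (eval_cons e y v) !mulgA.
Qed.

Lemma run_read w u h : (u, h) \in start_state base twist w ::
    [seq t.2 | t <- step_moves base twist steps w] ->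
  run (step_moves base twist steps w) (read_moves base twist steps w)
    (u, h) u ([::], h).
Proof.
move=> uh; suff sub v u' : u = u' ++ v ->
    run (step_moves base twist steps w) (read_moves base twist steps w)
      (v, h) v ([::], h) by apply: (sub u [::]).
elim: v u' => [|x v IH] u' def_u; first exact: run_nil.
apply: (@run_letter _ _ _ _ _ _ (v, h)); last first.
  by apply: (IH (rcons u' x)); rewrite cat_rcons.
apply/flatten_mapP; exists (u, h) => //; apply/mapP; exists (x, v) => //=.
by apply/mem_splits; exists u'.
Qed.

(** All heights on the way are at most the final one, because the remaining
    factors have nonnegative exponent sums of [a]; so each silent move used here
    is listed. *)
Lemma run_complete w us k : {subset us <= ws} ->
  Posz (count_mem up w) = (Posz k + exponent_sum a (flatten us))%R ->
  exists2 u, run (step_moves base twist steps w) (read_moves base twist steps w)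
      ([::], nseq k up) u (end_state X w) &
    eval e u = gen a ^+ k * eval gen (flatten us) * gen a ^- count_mem up w.
Proof.
elim: us k => [|v us IH] k us_ws /=.
  move=> def_k; have {def_k} <- : count_mem up w = k.
    by move: def_k; rewrite /exponent_sum /= GRing.subrr GRing.addr0 => -[].
  exists [::]; first by rewrite /end_state ascentE; apply: run_nil.
  by rewrite !eval_nil mulg1 mulgV.
rewrite exponent_sum_cat => def_k.
have ws_v : v \in ws by rewrite us_ws ?mem_head.
have us_ws' : {subset us <= ws}.
  by move=> x us_x; rewrite us_ws // inE us_x orbT.
have abs_v : Posz `|exponent_sum a v|%N = exponent_sum a v.
  by rewrite gez0_abs ?ws_ge0.
have us_ge0 : (0 <= exponent_sum a (flatten us))%R.
  elim: us us_ws' {IH us_ws def_k} => //= v' us IHus us_ws.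
  rewrite exponent_sum_cat; apply: Num.Theory.addr_ge0.
    by apply/ws_ge0/us_ws/mem_head.
  by apply: IHus => x us_x; rewrite us_ws // inE us_x orbT.
have le_k : k <= count_mem up w.
  rewrite -lez_nat def_k Num.Theory.lerDl.
  exact: Num.Theory.addr_ge0 (ws_ge0 ws_v) us_ge0.
have [|u run_u eval_u] := IH (k + `|exponent_sum a v|%N) us_ws'.
  by rewrite def_k PoszD abs_v GRing.addrA.
have k_q : (([::], nseq k up), (rw (nseq k up ++ v),
    nseq (k + `|exponent_sum a v|%N) up)) \in step_moves base twist steps w.
  by apply/step_movesP; exists k, v.
exists (rw (nseq k up ++ v) ++ u).
  apply: (run_eps k_q (run_cat (run_read _) run_u)).
  by rewrite inE; apply/orP; right; apply: (map_f snd k_q).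
rewrite eval_cat eval_u eval_rewrite_word !eval_cat eval_nseq_up.
by rewrite eval_a_part_nseq_up eval_a_part_step // -expgnDr !mulgA mulgVK.
Qed.

Lemma eval_a_part_descent w :
  eval a_part (descent w ++ w) = gen a ^+ count_mem up w.
Proof.
rewrite eval_cat descentE eval_a_part_nseq_up eval_a_part mulgA.
by rewrite (commuteX2 _ _ (commute_refl (gen a))) mulgK.
Qed.

Lemma acceptsP w : reflect (M (eval gen w)) (accepts base twist steps w).
Proof.
have start_val : state_value (start_state base twist w) =
    gen a ^+ count_mem up w * (eval gen w)^-1.
  rewrite /state_value /= eval_inv_word eval_rewrite_word eval_a_part_descent.
  rewrite eval_cat descentE eval_nseq_up eval_a_part_nseq_up !invgM invgK.
  by rewrite !mulgA mulgVK.
apply: (iffP (saturateP _ _ _ _)) => [/(dyck_run e)[u] |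
    /submonoid_genP[us us_ws def_w]].
  case/run_sound=> m Mm; rewrite start_val /state_value /= eval_nil => + u1.
  rewrite u1 !mul1g ascentE eval_a_part_nseq_up -mulgA -[RHS]mulg1.
  by move=> /mulgI/mulg1_eq; rewrite invgK => ->.
have es_w : Posz (count_mem up w) = (Posz (count_mem (a, true) w) +
    exponent_sum a (flatten us))%R.
  by rewrite -(exponent_sum_eval def_w) /exponent_sum GRing.addrC GRing.subrK.
have [u run_u eval_u] := run_complete us_ws es_w.
apply: (run_dyck e_ind); first apply: run_cat (run_read (mem_head _ _)) _.
  by rewrite descentE; exact: run_u.
rewrite eval_cat /= eval_inv_word eval_rewrite_word eval_a_part_descent.
rewrite eval_cat descentE eval_nseq_up eval_u def_w.
by rewrite mulVg.
Qed.

End Correctness.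

(** * The kernel has finite rank *)

Section FiniteRank.
Variables (G : groupType) (gen : ab -> G) (X : eqType) (e : X -> G).
Variable base : ab * bool -> word X.
Variable twist : ab * bool -> X * bool -> word X.
Hypothesis e_ind : independent e.
Hypothesis eval_base : forall l,
  eval e (base l) = (eval gen [:: l] * (eval (a_part gen) [:: l])^-1)%g.
Hypothesis eval_twist : forall l y, eval e (twist l y) =
  (eval (a_part gen) [:: l] * eval e [:: y] * (eval (a_part gen) [:: l])^-1)%g.
Import GRing.Theory.
Local Open Scope ring_scope.

(** The homomorphism from the free group to the rationals that extends [c]. *)
Definition additive_value (c : X -> rat) (u : word X) : rat :=
  \sum_(l <- u) (if l.2 then - c l.1 else c l.1).

(** Cancelling adjacent inverse letters does not change the value. *)
Lemma additive_value_eq c u v :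
  eval e u = eval e v -> additive_value c u = additive_value c v.
Proof.
move=> uv; have inv_v : additive_value c (inv_word v) = - additive_value c v.
  elim: v {uv} => [|l v IH]; first by rewrite /additive_value !big_nil oppr0.
  rewrite /inv_word map_cons rev_cons -cats1 /additive_value big_cat /=.
  rewrite -/(inv_word v) -/(additive_value c (inv_word v)) IH big_seq1 big_cons.
  by rewrite opprD addrC /=; case: l.2; rewrite ?opprK.
apply/eqP; rewrite -subr_eq0 -inv_v /additive_value -big_cat; apply/eqP.
have : eval e (u ++ inv_word v) = 1%g.
  by rewrite eval_cat eval_inv_word uv mulgV.
move: (u ++ _); apply: (independent_ind e_ind); first exact: big_nil.
move=> s x t; rewrite !big_cat => st; rewrite -[RHS]st !big_cons /=; congr (_ + _).
by case: x.2; rewrite addrA ?addNr ?addrN add0r.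
Qed.

Local Notation tau := (eval (a_part gen)).
Let value c w := additive_value c (rewrite_word base twist w).

Lemma value_eq c u v :
  (eval gen u * (tau u)^-1 = eval gen v * (tau v)^-1)%g ->
  value c u = value c v.
Proof.
move=> uv; apply: additive_value_eq.
by rewrite !(eval_rewrite_word eval_base eval_twist).
Qed.

Lemma value_nil c : value c [::] = 0.
Proof. exact: big_nil. Qed.

Lemma value_cat c u v : tau u = 1%g -> value c (u ++ v) = value c u + value c v.
Proof.
move=> u1; rewrite -[RHS]big_cat; apply: additive_value_eq.
rewrite eval_cat !(eval_rewrite_word eval_base eval_twist) !eval_cat u1.
by rewrite invg1 mulg1 mul1g mulgA.
Qed.

(** Conjugates of [b] by [t ^ (n - N)] are indexed by the natural number [n]:
    as the words considered have length at most [N], their heights, counted from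
    [-N], never become negative. *)
Section Shift.
Variable N : nat.

Definition shift n : word ab := nseq N (a, true) ++ nseq n up.
Definition shifted_b s n : word ab := shift n ++ (b, s) :: inv_word (shift n).

Lemma eval_shift n :
  (eval gen (shift n) = gen a ^- N * gen a ^+ n)%g /\
  (tau (shift n) = gen a ^- N * gen a ^+ n)%g.
Proof.
have down (g : ab -> G) :
    g a = gen a -> (eval g (nseq N (a, true)) = gen a ^- N)%g.
  move=> ga; rewrite -(invgK (eval g _)) -eval_inv_word -ga; congr (_ ^-1)%g.
  elim: (N) => [|k IH]; first by rewrite /inv_word eval_nil.
  by rewrite /inv_word /= rev_cons -cats1 eval_cat IH eval_letter /= expgSr.
by split; rewrite eval_cat ?eval_nseq_up ?eval_a_part_nseq_up down.
Qed.

Lemma eval_shifted_b (g : ab -> G) s n : eval g (shifted_b s n) =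
  (eval g (shift n) * eval g [:: (b, s)] * (eval g (shift n))^-1)%g.
Proof. by rewrite {1}/shifted_b eval_cat eval_cons eval_inv_word mulgA. Qed.

Lemma tau_shifted_b s n : tau (shifted_b s n) = 1%g.
Proof.
by rewrite eval_shifted_b eval_letter; case: s; rewrite /= ?invg1 mulg1 mulgV.
Qed.

Lemma value_shifted_inv c n :
  value c (shifted_b true n) = - value c (shifted_b false n).
Proof.
apply/eqP; rewrite -addr_eq0 -value_cat ?tau_shifted_b // -(value_nil c).
apply/eqP/value_eq; rewrite !(eval_cat _ (shifted_b _ _)) !tau_shifted_b.
rewrite !eval_nil !mul1g invg1 !mulg1.
by rewrite !eval_shifted_b !eval_letter /= !mulgA !mulgVK mulgV.
Qed.

(** The value of a word read from height [n], computed from the values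
    [delta i] of the conjugates of [b]. The predecessor is never truncated when
    [size w <= n]. *)
Fixpoint weight (delta : nat -> rat) n (w : word ab) : rat := match w with
  | [::] => 0
  | (a, false) :: w => weight delta n.+1 w
  | (a, true) :: w => weight delta n.-1 w
  | (b, s) :: w => (if s then - delta n else delta n) + weight delta n w
  end.

Lemma value_shift c n w : (size w <= n)%N ->
  value c (shift n ++ w) = weight (fun i => value c (shifted_b false i)) n w.
Proof.
elim: w n => [|[[] s] w IH] n le_w /=.
- rewrite cats0 -(value_nil c); apply: value_eq.
  by have [-> ->] := eval_shift n; rewrite !eval_nil !mulgV.
- case: s le_w => /= le_w.
    case: n le_w => // n le_w; rewrite -IH //; apply: value_eq.
    rewrite !(eval_cat _ (shift _)) !(eval_cons _ (a, true) w) !eval_letter /=.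
    have [-> ->] := eval_shift n.+1; have [-> ->] := eval_shift n.
    by rewrite expgSr !mulgA !mulgK.
  rewrite -IH; last exact: ltnW (ltnW _).
  apply: value_eq.
  rewrite !(eval_cat _ (shift _)) !(eval_cons _ up w) !eval_letter /=.
  have [-> ->] := eval_shift n.+1; have [-> ->] := eval_shift n.
  by rewrite expgSr !mulgA.
rewrite -IH; last exact: ltnW.
have -> : (if s then - value c (shifted_b false n)
           else value c (shifted_b false n)) = value c (shifted_b s n).
  by case: (s); rewrite ?value_shifted_inv.
rewrite -value_cat ?tau_shifted_b //; apply: value_eq.
rewrite !(eval_cat _ (shifted_b _ _)) !eval_shifted_b !(eval_cat _ (shift _)).
by rewrite !(eval_cons _ (b, s) w) !mulgA !mulgVK.
Qed.

(** The conjugates of a relator are trivial: this is the recurrence. *)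
Lemma value_relator c n r : (size r <= n)%N ->
  eval gen r = 1%g -> tau r = 1%g ->
  weight (fun i => value c (shifted_b false i)) n r = 0.
Proof.
move=> le_n r1 tr1; rewrite -value_shift // -(value_nil c); apply: value_eq.
have [shift_g shift_t] := eval_shift n.
rewrite !(eval_cat _ (shift _)) r1 tr1 shift_g shift_t !mulg1.
by rewrite !eval_nil !mulgV.
Qed.

(** The coefficient of [delta (k + j)] depends on [k] only: raising the starting
    height by [j] shifts the recurrence. *)
Lemma weight_expand delta K j n w : (size w <= n)%N -> (n + size w < K)%N ->
  weight delta (n + j) w =
  \sum_(k < K) weight (fun i => (i == k :> nat)%:R) n w * delta (k + j)%N.
Proof.
elim: w n => [|[[] s] w IH] n /= le_n lt_K.
- by rewrite big1 // => k _; rewrite mul0r.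
- case: s; last first.
    by rewrite -addSn IH ?addSnnS //; apply/ltnW/ltnW.
  case: n le_n lt_K => // n le_n lt_K; rewrite addSn /= IH //.
  by apply: leq_ltn_trans lt_K; rewrite leq_add.
rewrite IH //; [|exact: ltnW | by apply: leq_ltn_trans lt_K; rewrite leq_add].
under [in RHS]eq_bigr => k _ do rewrite mulrDl.
rewrite big_split /=; congr (_ + _).
have lt_nK : (n < K)%N by apply: leq_ltn_trans lt_K; rewrite leq_addr.
rewrite (bigD1 (Ordinal lt_nK)) //= eqxx big1 ?addr0 => [|k].
  by case: s; rewrite ?mulNr mul1r.
rewrite -val_eqE /= eq_sym => /negPf->.
by case: s; rewrite ?oppr0 mul0r.
Qed.

Lemma weight_eq0 delta n w : (forall i, delta i = 0) -> weight delta n w = 0.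
Proof.
move=> delta0; elim: w n => [|[[] s] w IH] n //=; first by case: s.
by rewrite IH delta0 oppr0 if_same addr0.
Qed.

Lemma weight_const1 n w : weight (fun=> 1) n w = (exponent_sum b w)%:~R.
Proof.
elim: w n => [|[[] s] w IH] n /=; first by [].
  by case: s; rewrite IH.
by rewrite IH -[in RHS](cat1s _ w) exponent_sum_cat intrD; case: s.
Qed.

End Shift.

Variable r : word ab.
Hypothesis r1 : eval gen r = 1%g.
Hypothesis tau_r1 : tau r = 1%g.
Hypothesis r_b : exponent_sum b r <> 0.
Hypothesis gen_e : forall x, exists w, eval gen w = e x /\ tau w = 1%g.

(** Let [d] be the largest index of a nonzero coefficient of the recurrence. If
    there were [d + 1] distinct basis elements, some nonzero combination [c] of
    their coordinate functions would vanish on the first [d] conjugates of [b],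
    hence on all later ones by the recurrence. The first conjugate can be taken
    low enough for the basis elements to be words in these conjugates; so [c]
    vanishes on them too, and all its coefficients are zero. *)
Lemma finite_rank : exists d, forall xs : seq X, uniq xs -> (size xs <= d)%N.
Proof.
pose p k := weight (fun i => (i == k :> nat)%:R) (size r) r.
pose K := (size r + size r).+1.
have ex_p : exists k, (k < K)%N && (p k != 0).
  (* The coefficients add up to the exponent sum of [b]. *)
  apply: contrapT => no_k; apply: r_b; apply/eqP.
  rewrite -(intr_eq0 rat) -(weight_const1 (size r + 0)).
  rewrite (weight_expand _ _ (leqnn _) (leqnn K)) big1 // => k _.
  rewrite mulr1; apply/eqP; apply: contrapT => /negP pk.
  by apply: no_k; exists k; rewrite ltn_ord.
have bound_p k : (k < K)%N && (p k != 0) -> (k <= K)%N by case/andP=> /ltnW.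
case: (ex_maxnP ex_p bound_p) => d /andP[lt_dK pd] max_d.
exists d => xs xs_uniq; rewrite leqNgt; apply/negP => lt_d.
have x0 : X by case: xs lt_d {xs_uniq}.
have [wx wxP] := choice gen_e.
pose N := \max_(x <- xs) size (wx x).
pose delta c i := value c (shifted_b N false i).
pose ind i x : rat := (x == nth x0 xs i)%:R.
pose A : 'M[rat]_(d.+1, d) := \matrix_(i, j) delta (ind i) j.
have [lam lam_neq0 lamA] : exists2 lam : 'rV_d.+1, lam != 0 & lam *m A = 0.
  have : kermx A != 0.
    by rewrite kermx_eq0 -row_leq_rank -ltnNge ltnS rank_leq_col.
  case/rowV0Pn=> v /sub_kermxP vA v0; by exists v.
pose c x := \sum_(i < d.+1) lam 0 i * ind i x.
have c_sum u :
    additive_value c u = \sum_(i < d.+1) lam 0 i * additive_value (ind i) u.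
  rewrite /additive_value; under [in RHS]eq_bigr => i _ do rewrite mulr_sumr.
  rewrite exchange_big; apply: eq_bigr => l _ /=; case: l.2 => //.
  by rewrite /c -sumrN; apply: eq_bigr => i _; rewrite mulrN.
have delta0 i : delta c i = 0.
  have [n] := ubnP i; elim: n i => // n IH i le_i.
  have [lt_id | le_di] := ltnP i d.
    move/matrixP/(_ 0 (Ordinal lt_id)): lamA; rewrite !mxE => lamA.
    rewrite /delta /value c_sum -[RHS]lamA; apply: eq_bigr => k _.
    by rewrite mxE.
  have : weight (delta c) (size r + (i - d)) r = 0.
    apply: value_relator => //; exact: leq_addr.
  rewrite (weight_expand _ _ (leqnn _) (leqnn K)) (bigD1 (Ordinal lt_dK)) //=.
  rewrite subnKC // big1 ?addr0 => [/eqP|k].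
    by rewrite mulf_eq0 (negPf pd) => /eqP.
  rewrite -val_eqE /= => k_d.
  have [lt_kd | lt_dk | eq_kd] := ltngtP k d; last by rewrite eq_kd eqxx in k_d.
    rewrite IH ?mulr0 //.
    apply: (@leq_trans i) => //.
    by rewrite -[X in (_ < X)%N](subnKC le_di) ltn_add2r.
  rewrite -/(p k); suff /eqP-> : p k == 0 by rewrite mul0r.
  apply: contraTT lt_dk => pk; rewrite -leqNgt; apply: max_d.
  by rewrite ltn_ord.
case/eqP: lam_neq0; apply/rowP => i; rewrite mxE.
have lt_i : (i < size xs)%N by apply: leq_trans (ltn_ord i) lt_d.
set x := nth x0 xs i.
have <- : c x = lam 0 i.
  rewrite /c (bigD1 i) //= /ind eqxx mulr1 big1 ?addr0 // => k k_i.
  rewrite nth_uniq // ?(leq_trans (ltn_ord k)) // eq_sym -val_eqE in k_i *.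
  by rewrite (negPf k_i) mulr0.
have [wx_g wx_t] := wxP x.
transitivity (value c (shift N N ++ wx x)).
  transitivity (additive_value c [:: (x, false)]).
    by rewrite /additive_value big_seq1.
  apply: additive_value_eq.
  rewrite (eval_rewrite_word eval_base eval_twist) !(eval_cat _ (shift _ _)).
  rewrite wx_g wx_t.
  have [-> ->] := eval_shift N N.
  by rewrite !mulVg !mul1g invg1 mulg1 eval_letter.
rewrite value_shift; last first.
  by apply: (leq_bigmax_seq x) => //; apply: mem_nth.
exact: weight_eq0.
Qed.

End FiniteRank.

(** * Decidability of membership *)

Lemma index_inj (A : eqType) (s : seq A) :
  (forall x, x \in s) -> injective (index^~ s).
Proof.
by move=> s_all x y eq_xy; rewrite -(nth_index x (s_all x)) eq_xy nth_index.
Qed.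

Definition index_encoding (A : eqType) (s : seq A) (s_all : forall x, x \in s) :
  encoding A := Encoding (index_inj s_all).

Definition rank_encoding (T : finType) : encoding T :=
  Encoding (inj_comp val_inj (@enum_rank_inj T)).

Lemma covering_seq (X : eqType) d :
  (forall xs : seq X, uniq xs -> size xs <= d) ->
  exists xs : seq X, forall x, x \in xs.
Proof.
move=> bounded; apply: contrapT => no_cover.
have [xs xs_uniq size_xs] : exists2 xs : seq X, uniq xs & size xs = d.+1.
  elim: d.+1 => [|n [xs xs_uniq <-]]; first by exists [::].
  have [x x_xs] : exists x, x \notin xs.
    apply: contrapT => no_x; apply: no_cover; exists xs => x.
    by apply: contrapT => /negP x_xs; apply: no_x; exists x.
  by exists (x :: xs); rewrite //= x_xs.
by have := bounded xs xs_uniq; rewrite size_xs ltnn.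
Qed.

Lemma submonoid_gen_mono (G : groupType) (S T : G -> Prop) g :
  (forall h, S h -> T h) -> submonoid_gen S g -> submonoid_gen T g.
Proof.
move=> ST; elim=> [h /ST | | h k _ Th _ Tk]; first exact: submonoid_gen_in.
  exact: submonoid_gen_one.
exact: submonoid_gen_mul.
Qed.

Lemma decidable_words_iff (B : finType) (P Q : word B -> Prop) :
  (forall w, P w <-> Q w) -> decidable_words P -> decidable_words Q.
Proof.
move=> PQ [chi rchi chiP]; exists chi => // w.
by have [pos neg] := chiP w; split=> [/PQ | nQ]; [exact: pos | apply: neg => /PQ].
Qed.

Section FreeByCyclic.
Variables (G : groupType) (gen : ab -> G) (r : word ab).
Hypothesis hG : presents (fun u => u = r) gen.
Hypothesis hfree : free_by_cyclic G.
Hypothesis ha : exponent_sum a r = 0%R.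
Hypothesis hb : exponent_sum b r <> 0%R.

(** A homomorphism [phi] witnessing that the group is free-by-cyclic kills [b],
    because [r] maps to [0]; so it is [phi (gen a)] times the exponent sum of
    [a]. This makes the exponent sum an invariant of the element and gives the
    tables [base] and [twist], whose entries are words for elements of the
    kernel. *)
Lemma membership_decidable (ws : seq (word ab)) :
  (forall w, w \in ws -> (0 <= exponent_sum a w)%R) ->
  decidable_membership gen
    (submonoid_gen (fun g => exists2 w, w \in ws & g = eval gen w)).
Proof.
move=> ws_ge0; have [phi [phiM phi_surj [X [e e_basis]]]] := hfree.
have [gen_surj gen_eq] := hG.
have phi1 : phi 1%g = 0%R.
  by apply: (GRing.addrI (phi 1%g)); rewrite -phiM mulg1 GRing.addr0.
have phiV g : phi (g^-1)%g = (- phi g)%R.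
  by apply/eqP; rewrite -GRing.addr_eq0 -phiM mulVg phi1.
have phi_eval w : phi (eval gen w) =
    (exponent_sum a w * phi (gen a) + exponent_sum b w * phi (gen b))%R.
  elim: w => [|l w IH]; first by rewrite eval_nil phi1 !GRing.mul0r.
  rewrite eval_cons phiM IH -[in RHS](cat1s l w) !exponent_sum_cat.
  rewrite !(GRing.mulrDl (exponent_sum _ [:: l])) GRing.addrACA eval_letter.
  congr (_ + _)%R.
  by case: l => [[] []]; rewrite /exponent_sum /= ?phiV ?GRing.subr0 ?GRing.sub0r
    ?GRing.mulN1r ?GRing.mul1r ?GRing.mul0r ?GRing.addr0 ?GRing.add0r.
have r1 : eval gen r = 1%g.
  by rewrite -[RHS](eval_nil gen); apply/gen_eq/word_eq_relator.
have phi_b : phi (gen b) = 0%R.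
  have := phi_eval r; rewrite r1 phi1 ha GRing.mul0r GRing.add0r => /esym/eqP.
  by rewrite GRing.mulf_eq0 => /orP[/eqP/hb | /eqP].
have phi_w w : phi (eval gen w) = (exponent_sum a w * phi (gen a))%R.
  by rewrite phi_eval phi_b GRing.mulr0 GRing.addr0.
have phi_a : phi (gen a) != 0%R.
  have [g phi_g] := phi_surj 1%R; have [w def_g] := gen_surj g.
  by apply: contra_eq_neq phi_g => phi_a; rewrite -def_g phi_w phi_a GRing.mulr0.
have es_eval u v : eval gen u = eval gen v -> exponent_sum a u = exponent_sum a v.
  by move=> uv; apply: (GRing.mulIf phi_a); rewrite -!phi_w uv.
have e_ind : independent e by apply: free_basis_independent e_basis phi1.
have [e_ker e_word] := e_basis.
have kerP g : phi g = 0%R -> exists u, eval e u = g.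
  by case/e_word=> u [[_ <-] _]; exists u.
have tau_letter l : phi (eval (a_part gen) [:: l]) = phi (eval gen [:: l]).
  by rewrite !eval_letter; case: l => [[] []] /=; rewrite ?phiV ?phi1 ?phi_b.
have /choice[base eval_base] l : exists u : word X,
    eval e u = (eval gen [:: l] * (eval (a_part gen) [:: l])^-1)%g.
  by apply: kerP; rewrite phiM phiV tau_letter GRing.subrr.
have /choice[tw eval_tw] (p : (ab * bool) * (X * bool)) : exists u : word X,
    eval e u = (eval (a_part gen) [:: p.1] * eval e [:: p.2] *
      (eval (a_part gen) [:: p.1])^-1)%g.
  apply: kerP; rewrite !phiM phiV GRing.addrAC GRing.subrr GRing.add0r eval_letter.
  by case: p.2.2; rewrite ?phiV e_ker ?GRing.oppr0.
pose twist l y := tw (l, y).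
have eval_twist l y : eval e (twist l y) = (eval (a_part gen) [:: l] *
    eval e [:: y] * (eval (a_part gen) [:: l])^-1)%g by apply: (eval_tw (l, y)).
have tau1 w : exponent_sum a w = 0%R -> eval (a_part gen) w = 1%g.
  rewrite eval_a_part /exponent_sum => /eqP; rewrite GRing.subr_eq0 => /eqP[->].
  exact: mulgV.
have gen_e x : exists w, eval gen w = e x /\ eval (a_part gen) w = 1%g.
  have [w def_w] := gen_surj (e x); exists w; split=> //; apply: tau1.
  by apply: (GRing.mulIf phi_a); rewrite -phi_w def_w e_ker GRing.mul0r.
have [d bounded] := finite_rank e_ind eval_base eval_twist r1 (tau1 _ ha) hb gen_e.
have [xs xsP] := covering_seq bounded.
pose letters := [seq (x, s) | x <- xs, s <- [:: false; true]].
have lettersP (l : X * bool) : l \in letters.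
  by case: l => x s; apply/allpairsP; exists (x, s); rewrite xsP; case: s.
pose eX := index_encoding lettersP.
(* With this encoding of the letters, the code of [w] is [word_code w]. *)
pose eA := rank_encoding (ab * bool)%type.
pose steps := [seq (w, nseq `|exponent_sum a w|%N up) | w <- ws].
have [g rg g_accepts] := computable_accepts base twist steps lettersP.
exists (fun v => g (thead v)) => // w.
have acc : g (word_code w) = accepts base twist steps w := g_accepts w.
have accP := acceptsP e_ind eval_base eval_twist ws_ge0 es_eval w.
by rewrite (_ : thead _ = word_code w) // acc; split=> /accP => [-> | /negPf->].
Qed.

Lemma positivity_decidable : decidable_positivity gen.
Proof.
have /membership_decidable : forall w : word ab,
    w \in [:: [:: (a, false)]; [:: (b, false)]] -> (0 <= exponent_sum a w)%R.
  by move=> w; rewrite !inE => /orP[] /eqP->.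
apply: decidable_words_iff => w; split; apply: submonoid_gen_mono => h.
  by case=> u; rewrite !inE => /orP[] /eqP-> ->; rewrite eval_letter; eexists.
case=> x ->; exists [:: (x, false)]; last by rewrite eval_letter.
by rewrite !inE; case: x.
Qed.

End FreeByCyclic.

Theorem theorem4p11 (G : groupType) (gen : ab -> G) (r : word ab)
  (hG : presents (fun u => u = r) gen)
  (hfree : free_by_cyclic G)
  (ha : exponent_sum a r = 0%R)
  (hb : exponent_sum b r <> 0%R) :
  (forall ws : seq (word ab),
     (forall w, w \in ws -> (0 <= exponent_sum a w)%R) ->
     decidable_membership gen
       (submonoid_gen (fun g => exists2 w, w \in ws & g = eval gen w))) /\
  decidable_positivity gen.
Proof.
split; first by move=> ws; apply: membership_decidable hG hfree ha hb _.
exact: positivity_decidable hG hfree ha hb.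
Qed.
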